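(* (Cuntz-Krieger Uniqueness Theorem) Let $E$ be a graph satisfying Condition (L), and let $R$ be a commutative ring with unit. If $S$ is a ring and $\phi : L_R(E) \to S$ is a ring homomorphism with the property that $\phi(\lambda v) \neq 0$ for all $v \in E^0$ and all $\lambda \in R \setminus \{0\}$, then $\phi$ is injective.
   Context: Graphs: a graph is a directed graph $E=(E^0,E^1,r,s)$ with countable sets $E^0$ (vertices), $E^1$ (edges) and maps $r,s:E^1\to E^0$ (range, source). A vertex $v$ is regular, $v\in E^0_{\mathrm{reg}}$, if $0<|s^{-1}(v)|<\infty$. A path of length $n\ge 1$ is $\alpha=e_1\cdots e_n$ with $e_i\in E^1$ and $r(e_i)=s(e_{i+1})$; put $|\alpha|=n$, $s(\alpha)=s(e_1)$, $r(\alpha)=r(e_n)$. Vertices are paths of length $0$ (with $r(v)=s(v)=v$). $E^n$ is the set of paths of length $n$, $E^*=\bigcup_{n\ge 0}E^n$. A cycle is a path $\alpha\in E^*\setminus E^0$ with $s(\alpha)=r(\alpha)$. An exit for $\alpha=e_1\cdots e_n$ is an edge $f\in E^1$ such that, for some $1\le i\le n$, $s(f)=s(e_i)$ but $f\ne e_i$. $E$ satisfies Condition (L) if every cycle in $E$ has an exit. Rings are not assumed commutative or unital, and ring homomorphisms are additive and multiplicative maps. For $R$ a commutative ring with unit $1$, an $R$-algebra is a ring $A$ that is also a left $R$-module with $\lambda(xy)=(\lambda x)y=x(\lambda y)$ and $1\cdot x=x$; homomorphisms of $R$-algebras are $R$-linear ring homomorphisms. A Leavitt $E$-family in a ring is a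 collection $\{v,e,e^*:v\in E^0,e\in E^1\}$ of elements such that the $v$'s are pairwise orthogonal idempotents and: (1) $s(e)e=er(e)=e$; (2) $r(e)e^*=e^*s(e)=e^*$; (3) $e^*f=\delta_{e,f}\,r(e)$ for all $e,f\in E^1$; (4) $v=\sum_{s(e)=v}ee^*$ for every $v\in E^0_{\mathrm{reg}}$. The Leavitt path algebra $L_R(E)$ is the universal $R$-algebra generated by a Leavitt $E$-family $\{v,e,e^*\}$: every Leavitt $E$-family $\{a_v,b_e,c_{e^*}\}$ in an $R$-algebra $A$ is the image of the generators under an $R$-algebra homomorphism $L_R(E)\to A$ with $v\mapsto a_v$, $e\mapsto b_e$, $e^*\mapsto c_{e^*}$. *)

(* Defs.v *)
From HB Require Import structures.
From mathcomp Require Import all_boot all_algebra.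
From mathcomp Require Import boolp classical_sets functions cardinality fsbigop.

Set Implicit Arguments.
Unset Strict Implicit.
Unset Printing Implicit Defensive.

Import GRing.Theory.

Local Open Scope classical_set_scope.
Local Open Scope ring_scope.
Local Open Scope quotient_scope.

(** ** Rings without unit and algebras over a commutative ring

    In a [rngType] or an [rngAlgType R] the addition is the one of [zmodType]
    (in [ring_scope]) and the product is the one of [semigroupType], written
    [(x * y)%g]; neither a unit nor commutativity of the product is assumed. *)

HB.mixin Record Zmodule_isRng A of GRing.Zmodule A & Semigroup A := {
  rng_mulDl : forall x y z : A, ((x + y)%R * z)%g = (x * z)%g + (y * z)%g;
  rng_mulDr : forall x y z : A, (x * (y + z)%R)%g = (x * y)%g + (x * z)%g
}.

#[short(type="rngType")]
HB.structure Definition Rng :=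
  { A of Zmodule_isRng A & GRing.Zmodule A & Semigroup A }.

HB.mixin Record Rng_isAlgebra (R : comPzRingType) A
    of Rng A & GRing.Lmodule R A := {
  rng_scaleAl : forall (l : R) (x y : A), l *: (x * y)%g = ((l *: x)%R * y)%g;
  rng_scaleAr : forall (l : R) (x y : A), l *: (x * y)%g = (x * (l *: y)%R)%g
}.

#[short(type="rngAlgType")]
HB.structure Definition RngAlgebra (R : comPzRingType) :=
  { A of Rng_isAlgebra R A & Rng A & GRing.Lmodule R A }.

HB.structure Definition RngMorphism (A B : rngType) :=
  { f of GRing.isNmodMorphism A B f & isMultiplicative A B f }.

Notation "{ 'rngmorphism' A -> B }" := (RngMorphism.type A%type B%type)
  (at level 0, A at level 98, B at level 99,
   format "{ 'rngmorphism'  A  ->  B }") : type_scope.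

HB.structure Definition RngAlgMorphism (R : comPzRingType)
    (A B : rngAlgType R) :=
  { f of @GRing.Linear R A B *:%R f & isMultiplicative A B f }.

Notation "{ 'rngalgmorphism' A -> B }" := (RngAlgMorphism.type A%type B%type)
  (at level 0, A at level 98, B at level 99,
   format "{ 'rngalgmorphism'  A  ->  B }") : type_scope.

(** ** Directed graphs *)

Record graph := Graph {
  vertex : countType;
  edge : countType;
  src : edge -> vertex;
  tgt : edge -> vertex
}.

Definition out_edges (E : graph) (v : vertex E) : set (edge E) :=
  [set e | src e = v].

Definition regular (E : graph) (v : vertex E) : Prop :=
  out_edges v !=set0 /\ finite_set (out_edges v).

(** [e :: p] is a path of length [(size p).+1]. *)
Definition graph_path (E : graph) (e : edge E) (p : seq (edge E)) : bool :=
  path (fun f f' => tgt f == src f') e p.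

(** A cycle is a closed path of length [>= 1]; it may visit a vertex several
    times. *)
Definition graph_cycle (E : graph) (a : seq (edge E)) : Prop :=
  if a is e :: p then graph_path e p /\ src e = tgt (last e p) else False.

Definition is_exit (E : graph) (a : seq (edge E)) (f : edge E) : Prop :=
  exists2 e : edge E, e \in a & src f = src e /\ f <> e.

Definition condition_L (E : graph) : Prop :=
  forall a : seq (edge E), graph_cycle a -> exists f, is_exit a f.

(** ** Leavitt families and Leavitt path algebras *)

Record leavitt_family (E : graph) (A : rngType) := LeavittFamily {
  lvertex : vertex E -> A;
  ledge : edge E -> A;
  lghost : edge E -> A;
  lvertexM : forall v w : vertex E,
    (lvertex v * lvertex w)%g = if v == w then lvertex v else 0;
  lsrc_edge : forall e : edge E, (lvertex (src e) * ledge e)%g = ledge e;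
  ledge_tgt : forall e : edge E, (ledge e * lvertex (tgt e))%g = ledge e;
  ltgt_ghost : forall e : edge E, (lvertex (tgt e) * lghost e)%g = lghost e;
  lghost_src : forall e : edge E, (lghost e * lvertex (src e))%g = lghost e;
  lghost_edge : forall e f : edge E,
    (lghost e * ledge f)%g = if e == f then lvertex (tgt e) else 0;
  lregular : forall v : vertex E, regular v ->
    lvertex v = \sum_(e \in out_edges v) (ledge e * lghost e)%g
}.

Definition family_set (E : graph) (A : rngType) (g : leavitt_family E A) :
    set A :=
  range (lvertex g) `|` range (ledge g) `|` range (lghost g).

Definition is_subalgebra (R : comPzRingType) (A : rngAlgType R) (B : set A) :
    Prop :=
  [/\ B 0,
      forall x y, B x -> B y -> B (x + y),
      forall (l : R) x, B x -> B (l *: x) &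
      forall x y, B x -> B y -> B (x * y)%g].

(** [L], together with the family [g], is the Leavitt path algebra of [E] over
    [R]: the universal [R]-algebra generated by a Leavitt [E]-family. It exists
    by [leavitt_path_algebra_exists] below. *)
Record is_leavitt_path_algebra (E : graph) (R : comPzRingType)
    (L : rngAlgType R) (g : leavitt_family E L) : Prop := {
  lpa_generated : smallest (@is_subalgebra R L) (family_set g) = setT;
  lpa_universal : forall (A : rngAlgType R) (h : leavitt_family E A),
    exists f : {rngalgmorphism L -> A},
      [/\ forall v, f (lvertex g v) = lvertex h v,
          forall e, f (ledge g e) = ledge h e &
          forall e, f (lghost g e) = lghost h e]
}.

(** ** Existence of the Leavitt path algebra

    The quotient of the algebra terms in the generators by the relation that
    identifies two terms when they have the same value for every Leavitt
    [E]-family in every [R]-algebra. *)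

Section Construction.

Variables (E : graph) (R : comPzRingType).

Inductive lterm : Type :=
  | LZero
  | LAdd of lterm & lterm
  | LOpp of lterm
  | LScale of R & lterm
  | LMul of lterm & lterm
  | LVertex of vertex E
  | LEdge of edge E
  | LGhost of edge E.

HB.instance Definition _ := gen_eqMixin lterm.
HB.instance Definition _ := gen_choiceMixin lterm.

Fixpoint leval (A : rngAlgType R) (h : leavitt_family E A) (t : lterm) : A :=
  match t with
  | LZero => 0
  | LAdd t u => leval h t + leval h u
  | LOpp t => - leval h t
  | LScale l t => l *: leval h t
  | LMul t u => (leval h t * leval h u)%g
  | LVertex v => lvertex h v
  | LEdge e => ledge h e
  | LGhost e => lghost h e
  end.

Definition lterm_eq (t u : lterm) : bool :=
  `[< forall (A : rngAlgType R) (h : leavitt_family E A),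
        leval h t = leval h u >].

Lemma lterm_eq_refl : reflexive lterm_eq.
Proof. by move=> t; apply/asboolP. Qed.

Lemma lterm_eq_sym : symmetric lterm_eq.
Proof.
by move=> t u; apply/asboolP/asboolP => tu A h; rewrite tu.
Qed.

Lemma lterm_eq_trans : transitive lterm_eq.
Proof.
by move=> u t w /asboolP tu /asboolP uw; apply/asboolP => A h; rewrite tu uw.
Qed.

Canonical lterm_equiv :=
  EquivRel lterm_eq lterm_eq_refl lterm_eq_sym lterm_eq_trans.

Definition lpa : Type := {eq_quot lterm_equiv}.
HB.instance Definition _ := Choice.on lpa.

Definition lclass (t : lterm) : lpa := (\pi_{eq_quot lterm_equiv} t)%qT.

Definition lpa_eval (A : rngAlgType R) (h : leavitt_family E A) (x : lpa) : A :=
  leval h (repr (x : {eq_quot lterm_equiv})).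

Lemma lpa_eval_class (A : rngAlgType R) (h : leavitt_family E A) (t : lterm) :
  lpa_eval h (lclass t) = leval h t.
Proof.
rewrite /lpa_eval /lclass.
have /eqmodP /asboolP -> // : (repr (\pi_{eq_quot lterm_equiv} t)%qT = t
  %[mod {eq_quot lterm_equiv}])%qT by rewrite reprK.
Qed.

Lemma lpa_ext (x y : lpa) :
  (forall (A : rngAlgType R) (h : leavitt_family E A),
     lpa_eval h x = lpa_eval h y) -> x = y.
Proof.
move=> xy; rewrite -[x](@reprK _ {eq_quot lterm_equiv}).
rewrite -[y](@reprK _ {eq_quot lterm_equiv}).
by apply/eqmodP/asboolP.
Qed.

Lemma lclass_repr (x : lpa) : exists t, x = lclass t.
Proof.
by exists (repr (x : {eq_quot lterm_equiv})); rewrite /lclass reprK.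
Qed.

Definition lpa_lift1 (c : lterm -> lterm) (x : lpa) : lpa :=
  lclass (c (repr (x : {eq_quot lterm_equiv}))).

Definition lpa_lift2 (c : lterm -> lterm -> lterm) (x y : lpa) : lpa :=
  lclass (c (repr (x : {eq_quot lterm_equiv}))
            (repr (y : {eq_quot lterm_equiv}))).

Definition lpa_zero := lclass LZero.
Definition lpa_add := lpa_lift2 LAdd.
Definition lpa_opp := lpa_lift1 LOpp.
Definition lpa_scale (l : R) := lpa_lift1 (LScale l).
Definition lpa_mul := lpa_lift2 LMul.

Section Eval.
Variables (A : rngAlgType R) (h : leavitt_family E A).

Lemma lpa_eval0 : lpa_eval h lpa_zero = 0.
Proof. exact: lpa_eval_class. Qed.
Lemma lpa_evalD x y : lpa_eval h (lpa_add x y) = lpa_eval h x + lpa_eval h y.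
Proof. exact: lpa_eval_class. Qed.
Lemma lpa_evalN x : lpa_eval h (lpa_opp x) = - lpa_eval h x.
Proof. exact: lpa_eval_class. Qed.
Lemma lpa_evalZ l x : lpa_eval h (lpa_scale l x) = l *: lpa_eval h x.
Proof. exact: lpa_eval_class. Qed.
Lemma lpa_evalM x y : lpa_eval h (lpa_mul x y) = (lpa_eval h x * lpa_eval h y)%g.
Proof. exact: lpa_eval_class. Qed.

End Eval.

Let lpaE := (lpa_eval0, lpa_evalD, lpa_evalN, lpa_evalZ, lpa_evalM).

Lemma lpa_addA : associative lpa_add.
Proof. by move=> x y z; apply: lpa_ext => A h; rewrite !lpaE addrA. Qed.
Lemma lpa_addC : commutative lpa_add.
Proof. by move=> x y; apply: lpa_ext => A h; rewrite !lpaE addrC. Qed.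
Lemma lpa_add0 : left_id lpa_zero lpa_add.
Proof. by move=> x; apply: lpa_ext => A h; rewrite !lpaE add0r. Qed.
Lemma lpa_addN : left_inverse lpa_zero lpa_opp lpa_add.
Proof. by move=> x; apply: lpa_ext => A h; rewrite !lpaE addNr. Qed.

HB.instance Definition _ :=
  GRing.isZmodule.Build lpa lpa_addA lpa_addC lpa_add0 lpa_addN.

Lemma lpa_mulA : associative lpa_mul.
Proof. by move=> x y z; apply: lpa_ext => A h; rewrite !lpaE mulgA. Qed.

HB.instance Definition _ := isSemigroup.Build lpa lpa_mulA.

Lemma lpa_mulDl (x y z : lpa) : ((x + y)%R * z)%g = (x * z)%g + (y * z)%g.
Proof.
apply: lpa_ext => A h.
by rewrite [LHS]lpa_evalM [RHS]lpa_evalD !lpaE rng_mulDl.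
Qed.
Lemma lpa_mulDr (x y z : lpa) : (x * (y + z)%R)%g = (x * y)%g + (x * z)%g.
Proof.
apply: lpa_ext => A h.
by rewrite [LHS]lpa_evalM [RHS]lpa_evalD !lpaE rng_mulDr.
Qed.

HB.instance Definition _ := Zmodule_isRng.Build lpa lpa_mulDl lpa_mulDr.

Lemma lpa_scaleA (a b : R) (x : lpa) :
  lpa_scale a (lpa_scale b x) = lpa_scale (a * b) x.
Proof. by apply: lpa_ext => A h; rewrite !lpaE scalerA. Qed.
Lemma lpa_scale1 : left_id 1 lpa_scale.
Proof. by move=> x; apply: lpa_ext => A h; rewrite !lpaE scale1r. Qed.
Lemma lpa_scaleDr : right_distributive lpa_scale +%R.
Proof.
move=> a x y; apply: lpa_ext => A h.
by rewrite lpa_evalZ [in LHS]lpa_evalD [RHS]lpa_evalD !lpaE scalerDr.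
Qed.
Lemma lpa_scaleDl (x : lpa) : {morph lpa_scale^~ x : a b / a + b}.
Proof.
move=> a b; apply: lpa_ext => A h.
by rewrite lpa_evalZ [RHS]lpa_evalD !lpaE scalerDl.
Qed.

HB.instance Definition _ := GRing.Zmodule_isLmodule.Build R lpa
  lpa_scaleA lpa_scale1 lpa_scaleDr lpa_scaleDl.

Lemma lpa_scaleAl (l : R) (x y : lpa) : l *: (x * y)%g = ((l *: x)%R * y)%g.
Proof.
apply: lpa_ext => A h.
by rewrite [LHS]lpa_evalZ [RHS]lpa_evalM !lpaE rng_scaleAl.
Qed.
Lemma lpa_scaleAr (l : R) (x y : lpa) : l *: (x * y)%g = (x * (l *: y)%R)%g.
Proof.
apply: lpa_ext => A h.
by rewrite [LHS]lpa_evalZ [RHS]lpa_evalM !lpaE rng_scaleAr.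
Qed.

HB.instance Definition _ := Rng_isAlgebra.Build R lpa lpa_scaleAl lpa_scaleAr.

Section EvalMorphism.
Variables (A : rngAlgType R) (h : leavitt_family E A).

Lemma lpa_eval_linear : linear (lpa_eval h).
Proof. by move=> l x y; rewrite [LHS]lpa_evalD lpa_evalZ. Qed.

HB.instance Definition _ :=
  GRing.isLinear.Build R lpa A *:%R (lpa_eval h) lpa_eval_linear.
HB.instance Definition _ :=
  isMultiplicative.Build lpa A (lpa_eval h) (lpa_evalM h).

End EvalMorphism.

Lemma lpa_vertexM (v w : vertex E) :
  (lclass (LVertex v) * lclass (LVertex w))%g =
  if v == w then lclass (LVertex v) else 0 :> lpa.
Proof.
apply: lpa_ext => A h; rewrite [LHS]lpa_evalM !lpa_eval_class /= lvertexM.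
by case: eqP => _; rewrite ?lpa_eval_class ?[RHS]lpa_eval0.
Qed.

Lemma lpa_ghost_edge (e f : edge E) :
  (lclass (LGhost e) * lclass (LEdge f))%g =
  if e == f then lclass (LVertex (tgt e)) else 0 :> lpa.
Proof.
apply: lpa_ext => A h; rewrite [LHS]lpa_evalM !lpa_eval_class /= lghost_edge.
by case: eqP => _; rewrite ?lpa_eval_class ?[RHS]lpa_eval0.
Qed.

Lemma lpa_src_edge (e : edge E) :
  (lclass (LVertex (src e)) * lclass (LEdge e))%g = lclass (LEdge e) :> lpa.
Proof.
apply: lpa_ext => A h.
by rewrite [LHS]lpa_evalM !lpa_eval_class /= lsrc_edge.
Qed.

Lemma lpa_edge_tgt (e : edge E) :
  (lclass (LEdge e) * lclass (LVertex (tgt e)))%g = lclass (LEdge e) :> lpa.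
Proof.
apply: lpa_ext => A h.
by rewrite [LHS]lpa_evalM !lpa_eval_class /= ledge_tgt.
Qed.

Lemma lpa_tgt_ghost (e : edge E) :
  (lclass (LVertex (tgt e)) * lclass (LGhost e))%g = lclass (LGhost e) :> lpa.
Proof.
apply: lpa_ext => A h.
by rewrite [LHS]lpa_evalM !lpa_eval_class /= ltgt_ghost.
Qed.

Lemma lpa_ghost_src (e : edge E) :
  (lclass (LGhost e) * lclass (LVertex (src e)))%g = lclass (LGhost e) :> lpa.
Proof.
apply: lpa_ext => A h.
by rewrite [LHS]lpa_evalM !lpa_eval_class /= lghost_src.
Qed.

Lemma lpa_regular (v : vertex E) : regular v ->
  lclass (LVertex v) =
  \sum_(e \in out_edges v) (lclass (LEdge e) * lclass (LGhost e))%g :> lpa.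
Proof.
move=> rv; have [_ fv] := rv; apply: lpa_ext => A h.
rewrite lpa_eval_class /= (lregular h rv) !fsbig_finite //=.
rewrite (raddf_sum (lpa_eval h)); apply: eq_bigr => e _.
by rewrite [RHS]lpa_evalM !lpa_eval_class.
Qed.

Definition lpa_family : leavitt_family E lpa :=
  LeavittFamily lpa_vertexM lpa_src_edge lpa_edge_tgt lpa_tgt_ghost
    lpa_ghost_src lpa_ghost_edge lpa_regular.

Lemma lpa_familyP : is_leavitt_path_algebra lpa_family.
Proof.
split=> [|A h]; last first.
  by exists (lpa_eval h); split=> x; rewrite /= lpa_eval_class.
apply/seteqP; split=> // x _ B [[B0 BD BZ BM] gB].
have [t ->{x}] := lclass_repr x.
have lclassE c u : B u -> (forall (A : rngAlgType R) (h : leavitt_family E A),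
    leval h c = lpa_eval h u) -> B (lclass c).
  move=> Bu cu; suff -> : lclass c = u by [].
  by apply: lpa_ext => A h; rewrite lpa_eval_class cu.
elim: t => [|t Bt u Bu|t Bt|l t Bt|t Bt u Bu|v|e|e].
- exact: B0.
- apply: (lclassE _ _ (BD _ _ Bt Bu)) => A h /=.
  by rewrite [RHS]lpa_evalD !lpa_eval_class.
- apply: (lclassE _ _ (BZ (-1) _ Bt)) => A h /=.
  by rewrite [RHS]lpa_evalZ !lpa_eval_class scaleN1r.
- apply: (lclassE _ _ (BZ l _ Bt)) => A h /=.
  by rewrite [RHS]lpa_evalZ !lpa_eval_class.
- apply: (lclassE _ _ (BM _ _ Bt Bu)) => A h /=.
  by rewrite [RHS]lpa_evalM !lpa_eval_class.
- by apply: gB; left; left; exists v.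
- by apply: gB; left; right; exists e.
- by apply: gB; right; exists e.
Qed.

End Construction.

Theorem leavitt_path_algebra_exists (E : graph) (R : comPzRingType) :
  exists (L : rngAlgType R) (g : leavitt_family E L),
    is_leavitt_path_algebra g.
Proof. by exists (lpa E R), (lpa_family E R); exact: lpa_familyP. Qed.

(* Main.v *)
Require Import Defs.
From mathcomp Require Import all_boot all_algebra.
From mathcomp Require Import boolp classical_sets cardinality fsbigop.

Set Implicit Arguments.
Unset Strict Implicit.
Unset Printing Implicit Defensive.

Import GRing.Theory.

Local Open Scope ring_scope.

(** Every element of [L] is a finite sum of monomials [a b^*], with [a] and
    [b] paths and [b^*] the product of the ghost edges of [b] in reverse order.
    To see that an element [x] of the kernel of [phi] is zero, one multiplies
    [x] on both sides by (ghost) paths, which keeps it in the kernel, until what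
    is left is [r v] with [r != 0], which the hypothesis on [phi] forbids.

    The first step is [vertex_plus_returns]: if [r != 0] then
    [x = r w + c_1 q_1 + ... + c_k q_k], where each [q_i] is a closed path of
    positive length at [w], is not in the kernel. For a path [p] from [w], the
    element [p^* x p] has again this form at the end of [p], with the same [r]:
    [p^* q_i p] is either [0], or a closed path with as many edges as [q_i]. An
    exit of the cycle [q_1] provides a [p] that leaves [q_1], so that
    [p^* q_1 p = 0], and one term disappears ([exit_path]). After at most [k]
    rounds only [r] times a vertex is left.

    Next, distinct paths are linearly independent modulo the kernel
    ([paths_independent]): if [a] is a shortest path with nonzero coefficient
    [r] in [x], then [a^* x w], with [w] the end of [a], has the above form.
    This takes the place of the usual grading of [L]; in particular no concrete
    representation of [L] is needed to see that its paths are independent.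

    Finally [ker_ghost_deg] goes by induction on the largest length [n] of the
    [b] in the monomials [a b^*] of [x]. For [n = 0] this is the independence of
    paths. Otherwise every [x e], with [e] an edge, is in the kernel and has
    smaller ghost length, hence [x e = 0]. As [x] is a finite sum of elements
    [x v], it remains to see that [x v = 0]. If [v] is regular, then [x v] is
    the sum of the [x e e^*] over the edges [e] that start at [v]. If not, this
    is [nonregular_vertex]: [x = a + y] where [a] is a combination of paths and
    all monomials of [y] contain a ghost edge. If [v] is a sink, then [y v = 0],
    and [x v = a v] is a combination of paths in the kernel. If [v] emits
    infinitely many edges, then one of them, say [e], satisfies [y e = 0], so
    that [a e = x e = 0], and [a v = 0] by independence of paths. Then
    [y f = x f - a f = 0] for all edges [f] from [v], whence [y v = 0]. *)

(** * Rings without unit *)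

Section RngTheory.
Variable A : rngType.
Implicit Types x y : A.

Lemma rng_mul0l x : (0 * x)%g = 0 :> A.
Proof. by apply: (addrI (0 * x)%g); rewrite -rng_mulDl !addr0. Qed.

Lemma rng_mul0r x : (x * 0)%g = 0 :> A.
Proof. by apply: (addrI (x * 0)%g); rewrite -rng_mulDr !addr0. Qed.

Lemma rng_mulr_suml (I : Type) (s : seq I) (P : pred I) (F : I -> A) x :
  ((\sum_(i <- s | P i) F i)%R * x)%g = \sum_(i <- s | P i) (F i * x)%g.
Proof.
by apply: (big_morph (fun y => (y * x)%g)) => [y z|];
   rewrite ?rng_mulDl ?rng_mul0l.
Qed.

Lemma rng_mulr_sumr (I : Type) (s : seq I) (P : pred I) (F : I -> A) x :
  (x * (\sum_(i <- s | P i) F i)%R)%g = \sum_(i <- s | P i) (x * F i)%g.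
Proof.
by apply: (big_morph (fun y => (x * y)%g)) => [y z|];
   rewrite ?rng_mulDr ?rng_mul0r.
Qed.

End RngTheory.

Lemma sum_delta (I : eqType) (V : zmodType) (s : seq I) i (F : I -> V) :
  uniq s -> i \in s -> \sum_(j <- s) (if i == j then F j else 0) = F i.
Proof.
move=> us si; rewrite (bigD1_seq i) //= eqxx big1 ?addr0 // => j.
by rewrite eq_sym => /negbTE->.
Qed.

(** * Paths and exits *)

Section Paths.
Variable E : graph.
Implicit Types (v w : vertex E) (e f : edge E) (p q : seq (edge E)).

(** The source is a parameter so that [[::]] stands for the path of length [0]
    at any chosen vertex. *)
Fixpoint path_from v p : bool :=
  if p is e :: p' then (src e == v) && path_from (tgt e) p' else true.

Definition path_end v p : vertex E := last v (map (@tgt E) p).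

Lemma path_from_cat v p q :
  path_from v (p ++ q) = path_from v p && path_from (path_end v p) q.
Proof. by elim: p v => //= e p IH v; rewrite IH andbA. Qed.

Lemma path_end_cons v e p : path_end v (e :: p) = path_end (tgt e) p.
Proof. by []. Qed.

Lemma path_end_cat v p q : path_end v (p ++ q) = path_end (path_end v p) q.
Proof. by rewrite /path_end map_cat last_cat. Qed.

Lemma closed_path_cycle v p :
  p != [::] -> path_from v p -> path_end v p = v -> graph_cycle p.
Proof.
case: p => // e p _ /= /andP[/eqP <-] pp.
rewrite /path_end /= last_map => <-; split=> //.
rewrite /graph_path; elim: p e pp => //= f p IH e /andP[/eqP sf pf].
by rewrite sf eqxx IH.
Qed.

(** Let [p] follow [q] up to the source of an exit [f], and then take [f]. The
    path [q p] starts with [q], which goes on with another edge there. *)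
Lemma exit_path v q : condition_L E ->
    q != [::] -> path_from v q -> path_end v q = v ->
  exists2 p, path_from v p & ~~ prefix p (q ++ p).
Proof.
move=> EL q0 qv qE; have [f [e eq [sf fe]]] := EL q (closed_path_cycle q0 qv qE).
case/splitPr: eq qv {q0 qE} => t r; rewrite path_from_cat => /andP[tv /= /andP[se _]].
exists (t ++ [:: f]); first by rewrite path_from_cat tv /= sf se.
rewrite -catA /=.
have -> : forall u, prefix (t ++ [:: f]) (t ++ e :: u) = (f == e).
  by move=> u; clear tv se; elim: t => [|a t IH] //=;
     rewrite ?prefix0s ?andbT ?eqxx.
by apply/eqP.
Qed.

End Paths.

(** * Paths and ghost paths in the algebra *)

Section PathElements.
Variables (E : graph) (R : comPzRingType) (L : rngAlgType R).
Variable g : leavitt_family E L.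
Implicit Types (x y : L) (v w : vertex E) (e f : edge E) (p q : seq (edge E)).

(** These are defined for all sequences of edges, so that products of paths need
    no side condition: the value is zero unless [p] is a path from [v]. *)
Fixpoint path_elt v p : L :=
  if p is e :: p' then (lvertex g v * (ledge g e * path_elt (tgt e) p'))%g
  else lvertex g v.

Fixpoint ghost_elt v p : L :=
  if p is e :: p' then (ghost_elt (tgt e) p' * (lghost g e * lvertex g v))%g
  else lvertex g v.

Lemma lvertex_edge v e :
  (lvertex g v * ledge g e)%g = if v == src e then ledge g e else 0.
Proof.
rewrite -[in LHS](lsrc_edge g e) mulgA lvertexM.
by case: eqP => [->|_]; rewrite ?lsrc_edge ?rng_mul0l.
Qed.

Lemma lghost_vertex e v :
  (lghost g e * lvertex g v)%g = if src e == v then lghost g e else 0.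
Proof.
rewrite -[in LHS](lghost_src g e) -mulgA lvertexM.
by case: eqP => _; rewrite ?lghost_src ?rng_mul0r.
Qed.

Lemma lvertex_path w v p :
  (lvertex g w * path_elt v p)%g = if w == v then path_elt v p else 0.
Proof.
case: p => [|e p] /=; first by rewrite lvertexM; case: eqP => // ->.
by rewrite mulgA lvertexM; case: eqP => [->|_]; rewrite ?rng_mul0l.
Qed.

Lemma ghost_vertex v p w :
  (ghost_elt v p * lvertex g w)%g = if v == w then ghost_elt v p else 0.
Proof.
case: p => [|e p] /=; first by rewrite lvertexM.
by rewrite -!mulgA lvertexM; case: eqP => _; rewrite ?rng_mul0r.
Qed.

Lemma path_vertex v p w :
  (path_elt v p * lvertex g w)%g = if path_end v p == w then path_elt v p else 0.
Proof.
elim: p v => [|e p IH] v /=; first exact: lvertexM.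
by rewrite -!mulgA IH path_end_cons; case: eqP => _; rewrite ?rng_mul0r.
Qed.

Lemma path_not v p : ~~ path_from v p -> path_elt v p = 0.
Proof.
elim: p v => //= e p IH v; rewrite negb_and => /orP[sv|/IH->].
  by rewrite mulgA lvertex_edge eq_sym (negbTE sv) rng_mul0l.
by rewrite !rng_mul0r.
Qed.

Lemma path_mul v p w q :
  (path_elt v p * path_elt w q)%g =
  if path_end v p == w then path_elt v (p ++ q) else 0.
Proof.
elim: p v => [|e p IH] v /=.
  by rewrite lvertex_path; case: eqP => // ->.
by rewrite -!mulgA IH path_end_cons; case: eqP => _; rewrite ?rng_mul0r.
Qed.

Lemma ghost_mul w q v p :
  (ghost_elt w q * ghost_elt v p)%g =
  if path_end v p == w then ghost_elt v (p ++ q) else 0.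
Proof.
elim: p v => [|e p IH] v /=.
  by rewrite ghost_vertex eq_sym; case: eqP => // ->.
by rewrite mulgA IH path_end_cons; case: eqP => _; rewrite ?rng_mul0l.
Qed.

Lemma path_rcons v p e :
  path_elt v (rcons p e) = (path_elt v p * ledge g e)%g.
Proof.
elim: p v => [|f p IH] v /=; first by rewrite ledge_tgt.
by rewrite IH !mulgA.
Qed.

Lemma ghost_path_cons w e p v f q :
  (ghost_elt w (e :: p) * path_elt v (f :: q))%g =
  if [&& w == v, src e == v & e == f]
  then (ghost_elt (tgt e) p * path_elt (tgt e) q)%g else 0.
Proof.
rewrite /= -!mulgA (mulgA (lvertex g w)) lvertexM.
case: eqP => [->|_] /=; last by rewrite !(rng_mul0l, rng_mul0r).
rewrite (mulgA (lghost g e)) lghost_vertex.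
case: eqP => [_|_] /=; last by rewrite !(rng_mul0l, rng_mul0r).
rewrite (mulgA (lghost g e)) lghost_edge.
case: eqP => [->|_] /=; last by rewrite !(rng_mul0l, rng_mul0r).
by rewrite lvertex_path eqxx.
Qed.

Lemma ghost_path w p v q : (size p <= size q)%N ->
  (ghost_elt w p * path_elt v q)%g =
  if [&& w == v, path_from v p & prefix p q]
  then path_elt (path_end v p) (drop (size p) q) else 0.
Proof.
elim: p w v q => [|e p IH] w v [|f q] //= pq.
- by rewrite lvertexM andbT; case: eqP => // ->.
- by rewrite -/(path_elt v (f :: q)) lvertex_path andbT; case: eqP => // ->.
rewrite -/(ghost_elt w (e :: p)) -/(path_elt v (f :: q)) ghost_path_cons IH //.
case: eqP => //= _; case: eqP => //= _.
by rewrite eqxx; case: (e == f); rewrite ?andbF.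
Qed.

(** The monomials [a b^*] are closed under product up to [0], by this rule.
    Whichever of the two paths is longer, cancellation leaves at most what
    remains of it. *)
Lemma ghost_path_cases w q v p :
  [\/ (ghost_elt w q * path_elt v p)%g = 0,
      exists u r, (ghost_elt w q * path_elt v p)%g = path_elt u r |
      exists u r, (ghost_elt w q * path_elt v p)%g = ghost_elt u r].
Proof.
elim: q w v p => [|e q IH] w v p.
  rewrite lvertex_path; case: eqP => _; [constructor 2|constructor 1] => //.
  by exists v, p.
case: p => [|f p].
  rewrite ghost_vertex; case: eqP => _; [constructor 3|constructor 1] => //.
  by exists w, (e :: q).
by rewrite ghost_path_cons; case: ifP => _; [exact: IH|constructor 1].
Qed.

(** A filtration rather than a degree function: the monomials [a b^*] are not
    linearly independent in general, because of the relation at regular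
    vertices. *)
Inductive ghost_deg (n : nat) : L -> Prop :=
  | Ghost_deg0 : ghost_deg n 0
  | Ghost_degD x y : ghost_deg n x -> ghost_deg n y -> ghost_deg n (x + y)
  | Ghost_degM (c : R) v p w q : (size q <= n)%N ->
      ghost_deg n (c *: (path_elt v p * ghost_elt w q)%g).

Lemma ghost_degW m n x : (m <= n)%N -> ghost_deg m x -> ghost_deg n x.
Proof.
move=> mn; elim=> [|y z _ ? _ ?|c v p w q qm]; first exact: Ghost_deg0.
  exact: Ghost_degD.
exact: Ghost_degM (leq_trans qm mn).
Qed.

Lemma ghost_deg_path n (c : R) v p : ghost_deg n (c *: path_elt v p).
Proof.
have -> : path_elt v p = (path_elt v p * ghost_elt (path_end v p) [::])%g.
  by rewrite path_vertex eqxx.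
exact: Ghost_degM.
Qed.

Lemma ghost_deg_vertex n x v : ghost_deg n x -> ghost_deg n (x * lvertex g v)%g.
Proof.
elim=> [|y z _ ? _ ?|c u p w q qn]; first by rewrite rng_mul0l; constructor.
  by rewrite rng_mulDl; constructor.
rewrite -rng_scaleAl -mulgA ghost_vertex.
by case: eqP => _; [|rewrite rng_mul0r scaler0]; constructor.
Qed.

Lemma ghost_deg_edge n x e : ghost_deg n x -> ghost_deg n.-1 (x * ledge g e)%g.
Proof.
elim=> [|y z _ ? _ ?|c u p w [|f q] qn]; first by rewrite rng_mul0l; constructor.
- by rewrite rng_mulDl; constructor.
- rewrite -rng_scaleAl path_vertex; case: eqP => _.
    by rewrite -path_rcons; apply: ghost_deg_path.
  by rewrite rng_mul0l scaler0; constructor.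
rewrite -rng_scaleAl -mulgA.
have -> : ledge g e = path_elt (src e) [:: e] by rewrite /= ledge_tgt lsrc_edge.
rewrite ghost_path_cons; case: ifP => _; last first.
  by rewrite rng_mul0r scaler0; constructor.
by rewrite ghost_vertex eqxx; constructor; case: n qn.
Qed.


Lemma ghost_deg_scale n (c : R) x : ghost_deg n x -> ghost_deg n (c *: x).
Proof.
elim=> [|y z _ ? _ ?|d u p w q qn]; first by rewrite scaler0; constructor.
  by rewrite scalerDr; constructor.
by rewrite scalerA; constructor.
Qed.

Lemma ghost_deg_mul x y : (exists n, ghost_deg n x) -> (exists n, ghost_deg n y) ->
  exists n, ghost_deg n (x * y)%g.
Proof.
have add x1 x2 : (exists n, ghost_deg n x1) -> (exists n, ghost_deg n x2) ->
    exists n, ghost_deg n (x1 + x2).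
  move=> [n xn] [m ym]; exists (n + m)%N.
  by apply: Ghost_degD; [move: xn|move: ym]; apply: ghost_degW;
     rewrite ?leq_addr ?leq_addl.
have zero : exists n, ghost_deg n (0 : L) by exists 0%N; constructor.
case=> n; elim=> [|x1 x2 _ IH1 _ IH2|c u p w q qn] yM; first by rewrite rng_mul0l.
  by rewrite rng_mulDl; apply: add; [exact: IH1|exact: IH2].
case: yM => m; elim=> [|y1 y2 _ IH1 _ IH2|d u' p' w' q' qm].
- by rewrite rng_mul0r.
- by rewrite rng_mulDr; apply: add.
rewrite -rng_scaleAl -rng_scaleAr scalerA -mulgA (mulgA _ (path_elt u' p')).
have [->|[v [r ->]]|[v [r ->]]] := ghost_path_cases w q u' p'.
- by rewrite rng_mul0l rng_mul0r scaler0.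
- rewrite mulgA path_mul; case: eqP => _; last by rewrite rng_mul0l scaler0.
  by exists (size q'); constructor.
rewrite ghost_mul; case: eqP => _; last by rewrite rng_mul0r scaler0.
by exists (size (q' ++ r)); constructor.
Qed.

Lemma ghost_deg_total : is_leavitt_path_algebra g ->
  forall x, exists n, ghost_deg n x.
Proof.
move=> [gen _] x.
suff : (smallest (@is_subalgebra R L) (family_set g) `<=`
        [set y | exists n, ghost_deg n y])%classic.
  by rewrite gen => /(_ x I).
apply: smallest_sub; first split.
- by exists 0%N; constructor.
- move=> y z [n yn] [m zm]; exists (n + m)%N.
  by apply: Ghost_degD; [move: yn|move: zm]; apply: ghost_degW;
     rewrite ?leq_addr ?leq_addl.
- by move=> c y [n yn]; exists n; apply: ghost_deg_scale.
- exact: ghost_deg_mul.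
move=> _ [[[v _ <-]|[e _ <-]]|[e _ <-]].
- by exists 0%N; rewrite -[lvertex g v]scale1r; apply: (ghost_deg_path _ _ _ [::]).
- exists 0%N; rewrite -lsrc_edge -[(_ * _)%g]scale1r.
  by rewrite -(path_rcons _ [::]); apply: ghost_deg_path.
- exists 1%N; rewrite -ltgt_ghost -lghost_src mulgA -[(_ * _)%g]scale1r.
  rewrite -[(_ * _ * _)%g]mulgA.
  have -> : (lvertex g (tgt e) * (lghost g e * lvertex g (src e)))%g =
     (path_elt (tgt e) [::] * ghost_elt (src e) [:: e])%g.
    by rewrite /= !mulgA lvertexM eqxx.
  by constructor.
Qed.

(** Finite sums of vertices serve as local units. The statement holds for all
    large enough [s'], which makes it additive in [x]. *)
Lemma vertex_decomposition n x : ghost_deg n x ->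
  exists s : seq (vertex E), forall s', uniq s' -> {subset s <= s'} ->
    x = \sum_(v <- s') (x * lvertex g v)%g.
Proof.
elim=> [|y z _ [s1 H1] _ [s2 H2]|c u p w q _].
- by exists [::] => s' _ _; rewrite big1 // => v _; rewrite rng_mul0l.
- exists (s1 ++ s2) => s' us ss; under eq_bigr do rewrite rng_mulDl.
  rewrite big_split /= -H1 -?H2 // => v vs; apply: ss;
    by rewrite mem_cat vs ?orbT.
exists [:: w] => s' us ss.
have ws : w \in s' by apply: ss; rewrite inE.
rewrite -[LHS](sum_delta (fun=> c *: (path_elt u p * ghost_elt w q)%g) us ws).
apply: eq_bigr => v _; rewrite -rng_scaleAl -mulgA ghost_vertex.
by case: eqP; rewrite ?rng_mul0r ?scaler0.
Qed.

(** Every element is a combination of paths plus some [y] that is recovered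
    from finitely many of the products [y e] (where [y] collects the monomials
    that contain a ghost edge): [f^* e e^*] is [f^*] if [e = f], and [0]
    otherwise. *)
Lemma edge_decomposition n x : ghost_deg n x ->
  exists x0 y (s : seq (edge E)), [/\ x = x0 + y, ghost_deg 0 x0 &
    forall s', uniq s' -> {subset s <= s'} ->
      y = \sum_(e <- s') (y * ledge g e * lghost g e)%g].
Proof.
elim=> [|x1 x2 _ [a1 [b1 [s1 [-> A1 H1]]]] _ [a2 [b2 [s2 [-> A2 H2]]]]|c u p w [|f q] _].
- exists 0, 0, [::]; rewrite add0r; split=> //; first by constructor.
  by move=> s' _ _; rewrite big1 // => v _; rewrite !rng_mul0l.
- exists (a1 + a2), (b1 + b2), (s1 ++ s2); rewrite addrACA; split=> //.
    by constructor.
  move=> s' us ss; under eq_bigr do rewrite !rng_mulDl.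
  rewrite big_split /= -H1 -?H2 // => v vs; apply: ss;
    by rewrite mem_cat vs ?orbT.
- exists (c *: (path_elt u p * ghost_elt w [::])%g), 0, [::].
  rewrite addr0; split=> //; first by constructor.
  by move=> s' _ _; rewrite big1 // => v _; rewrite !rng_mul0l.
exists 0, (c *: (path_elt u p * ghost_elt w (f :: q))%g), [:: f].
rewrite add0r; split=> //; first by constructor.
move=> s' us ss; have fs : f \in s' by apply: ss; rewrite inE.
rewrite -[LHS](sum_delta (fun=> c *: (path_elt u p * ghost_elt w (f :: q))%g) us fs).
apply: eq_bigr => e _; rewrite -!rng_scaleAl /= lghost_vertex.
case: (src f == w); last by rewrite !(rng_mul0r, rng_mul0l) scaler0 if_same.
rewrite -!mulgA (mulgA (lghost g f)) lghost_edge; case: eqP => [->|_].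
  by rewrite ltgt_ghost.
by rewrite !(rng_mul0r, rng_mul0l) scaler0.
Qed.

Lemma path_decomposition x : ghost_deg 0 x ->
  exists (c : vertex E * seq (edge E) -> R) s, uniq s /\
    x = \sum_(t <- s) c t *: path_elt t.1 t.2.
Proof.
suff H : ghost_deg 0 x -> exists (c : vertex E * seq (edge E) -> R)
      (s : seq (vertex E * seq (edge E))),
    forall s', uniq s' -> {subset s <= s'} ->
      x = \sum_(t <- s') c t *: path_elt t.1 t.2.
  move=> xP; have [c [s sP]] := H xP; exists c, (undup s).
  split; first exact: undup_uniq.
  by apply: (sP (undup s) (undup_uniq s)) => t; rewrite mem_undup.
elim=> [|y z _ [c1 [s1 H1]] _ [c2 [s2 H2]]|c u p w [|//] _].
- by exists (fun=> 0), [::] => s' _ _; rewrite big1 // => v _; rewrite scale0r.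
- exists (fun t => c1 t + c2 t), (s1 ++ s2) => s' us ss.
  under eq_bigr do rewrite scalerDl.
  rewrite big_split /= -H1 -?H2 // => v vs; apply: ss;
    by rewrite mem_cat vs ?orbT.
rewrite path_vertex.
exists (fun t => if (u, p) == t then if path_end u p == w then c else 0 else 0).
exists [:: (u, p)] => s' us ss; have ts : (u, p) \in s' by apply: ss; rewrite inE.
pose F (t : vertex E * seq (edge E)) :=
  (if path_end u p == w then c else 0) *: path_elt t.1 t.2.
under eq_bigr do rewrite (fun_if (fun d => d *: _)) scale0r -/(F _).
rewrite (sum_delta F us ts) /F /=.
by case: eqP; rewrite ?scaler0 ?scale0r.
Qed.

End PathElements.

(** * The kernel of a homomorphism that is nonzero on multiples of vertices *)

Section Kernel.
Variables (E : graph) (R : comPzRingType) (L : rngAlgType R).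
Variables (g : leavitt_family E L) (S : rngType) (phi : {rngmorphism L -> S}).
Hypothesis EL : condition_L E.
Hypothesis phi_vertex :
  forall (v : vertex E) (l : R), l != 0 -> phi (l *: lvertex g v) != 0.
Implicit Types (x y : L) (v w : vertex E) (e f : edge E) (p q : seq (edge E)).

Lemma phi_mull x y : phi x = 0 -> phi (x * y)%g = 0.
Proof. by move=> x0; rewrite gmulfM /= x0 rng_mul0l. Qed.

Lemma phi_mulr x y : phi y = 0 -> phi (x * y)%g = 0.
Proof. by move=> y0; rewrite gmulfM /= y0 rng_mul0r. Qed.

(** [0] is allowed because compression by a path may kill a term. *)
Definition return_term w x : Prop :=
  x = 0 \/ exists (c : R) q,
    [/\ q != [::], path_from w q, path_end w q = w & x = c *: path_elt g w q].

(** If [q p] starts with [p], then [q p = p t] and [p^* q p = t]; here [t] is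
    closed, and as long as [q]. Otherwise [p^* q p = 0]. *)
Lemma return_term_conj w x p : path_from w p -> return_term w x ->
  return_term (path_end w p) (ghost_elt g w p * x * path_elt g w p)%g.
Proof.
move=> wp [->|[c [q [q0 wq qE ->]]]].
  by left; rewrite rng_mul0r rng_mul0l.
rewrite -rng_scaleAr -rng_scaleAl -mulgA path_mul qE eqxx.
rewrite ghost_path ?size_cat ?leq_addl // eqxx wp /=.
case: ifP => [/prefixP[t qp]|_]; last by left; rewrite scaler0.
right; exists c, t; rewrite qp drop_size_cat //.
have: path_from w (p ++ t) by rewrite -qp path_from_cat wq qE.
rewrite path_from_cat wp => /= tp; split=> //.
  by apply: contraNneq q0 => t0; move/(congr1 size): qp;
     rewrite t0 cats0 size_cat -[RHS]add0n => /addIn/size0nil->.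
by rewrite -path_end_cat -qp path_end_cat qE.
Qed.

(** By Condition (L), compression by a path that leaves the first closed path
    [q] at an exit kills the corresponding term, whereas the coefficient at the
    vertex survives; the other terms remain return terms. *)
Lemma vertex_plus_returns (r : R) w (s : seq L) : r != 0 ->
  (forall x, x \in s -> return_term w x) ->
  phi (r *: lvertex g w + \sum_(x <- s) x) != 0.
Proof.
move=> r0; have [n] := ubnP (size s); elim: n s w => // n IH [|y s] w sn ws.
  by rewrite big_nil addr0 phi_vertex.
have ss x : x \in s -> return_term w x by move=> xs; apply: ws; rewrite inE xs orbT.
rewrite big_cons; case: (ws y (mem_head _ _)) => [->|[c [q [q0 wq qE ->]]]].
  by rewrite add0r IH.
have [p wp pN] := exit_path EL q0 wq qE.
pose C x := (ghost_elt g w p * x * path_elt g w p)%g.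
have CD x x' : C (x + x') = C x + C x' by rewrite /C rng_mulDr rng_mulDl.
have Cw : C (r *: lvertex g w) = r *: lvertex g (path_end w p).
  rewrite /C -rng_scaleAr -rng_scaleAl ghost_vertex eqxx ghost_path //.
  by rewrite eqxx wp prefix_refl drop_size.
have Cq : C (c *: path_elt g w q) = 0.
  rewrite /C -rng_scaleAr -rng_scaleAl -mulgA path_mul qE eqxx.
  by rewrite ghost_path ?size_cat ?leq_addl // (negbTE pN) !andbF scaler0.
have Cs : C (\sum_(x <- s) x) = \sum_(x <- map C s) x.
  by rewrite big_map /C rng_mulr_sumr rng_mulr_suml.
apply: contra_neq (IH (map C s) (path_end w p) _ _) => [x0||x /mapP[z zs ->]].
  by rewrite -[X in _ + X]add0r -Cs -Cw -{1}Cq -!CD phi_mull ?phi_mulr.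
  by rewrite size_map.
exact: return_term_conj (ss z zs).
Qed.

(** If [a] is a shortest path with nonzero coefficient, then for another path
    [b] of the sum, [a^* b] is [0] or the rest [t] of [b = a t], of positive
    length since [b] is not [a]. Multiplication by the end of [a] removes those
    [t] that are not closed, and [vertex_plus_returns] applies. *)
Lemma paths_independent (I : eqType) (s : seq I) (c : I -> R)
    (P : I -> vertex E * seq (edge E)) :
  injective P -> uniq s ->
  phi (\sum_(i <- s) c i *: path_elt g (P i).1 (P i).2) = 0 ->
  forall i, i \in s -> path_from (P i).1 (P i).2 -> c i = 0.
Proof.
move=> Pinj us x0 i1 i1s Pi1; apply/eqP/negPn/negP => ci1.
pose Q i := (c i != 0) && path_from (P i).1 (P i).2.
have exQ : exists n, has (fun i => Q i && (size (P i).2 == n)) s.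
  by exists (size (P i1).2); apply/hasP; exists i1; rewrite // /Q ci1 Pi1 eqxx.
case: (ex_minnP exQ) => n /hasP[i is_ /andP[/andP[ci Pi] /eqP <-]] minn {exQ}.
(* [P i] is a shortest path with nonzero coefficient. *)
set v := (P i).1; set p := (P i).2; set w := path_end v p.
pose C x := (ghost_elt g v p * x * lvertex g w)%g.
pose T j := c j *: path_elt g (P j).1 (P j).2.
suff ret : forall x, x \in [seq C (T j) | j <- rem i s] -> return_term w x.
  apply/negP: (vertex_plus_returns ci ret); rewrite negbK big_map.
  rewrite /C -rng_mulr_suml -rng_mulr_sumr -/(C _).
  have <- : C (T i) = c i *: lvertex g w.
    rewrite /C /T -rng_scaleAr -rng_scaleAl ghost_path // eqxx Pi prefix_refl.
    by rewrite drop_size /= lvertexM eqxx.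
  rewrite /C -rng_mulDl -rng_mulDr.
  rewrite -(big_rem i (P := predT) (F := T)) //.
  by rewrite phi_mull ?phi_mulr.
move=> x /mapP[j]; rewrite mem_rem_uniq // inE => /andP[ji js] ->.
rewrite /C /T -rng_scaleAr -rng_scaleAl.
have [->|cj] := eqVneq (c j) 0; first by left; rewrite scale0r.
have [Pj|/path_not->] := boolP (path_from (P j).1 (P j).2); last first.
  by left; rewrite rng_mul0r rng_mul0l scaler0.
rewrite ghost_path; last first.
  by apply: minn; apply/hasP; exists j; rewrite // /Q cj Pj eqxx.
case: ifP => [/and3P[/eqP vj _ /prefixP[t pt]]|_]; last by left; rewrite rng_mul0l scaler0.
rewrite -vj pt drop_size_cat // path_vertex -/w.
case: eqP => tE; last by left; rewrite scaler0.
right; exists (c j), t; split=> //.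
  apply: contraNneq ji => t0; apply/eqP/Pinj.
  by rewrite [P j]surjective_pairing [P i]surjective_pairing -vj pt t0 cats0.
by move: Pj; rewrite pt path_from_cat -vj => /andP[].
Qed.

Lemma ker_paths x : ghost_deg g 0 x -> phi x = 0 -> x = 0.
Proof.
move=> /path_decomposition[c [s [us ->]]] x0.
rewrite big_seq big1 // => t ts.
have [Pt|/path_not->] := boolP (path_from t.1 t.2); last by rewrite scaler0.
by rewrite (@paths_independent _ s c id _ us x0 t ts) ?scale0r.
Qed.

(** Paths that end at the source of [e] remain distinct when they are extended
    by [e]; thus right multiplication by [e] is injective on their span. *)
Lemma ker_paths_edge x e : ghost_deg g 0 x ->
  phi (x * ledge g e)%g = 0 -> (x * lvertex g (src e))%g = 0.
Proof.
move=> /path_decomposition[c [s [us ->]]].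
rewrite !rng_mulr_suml.
under eq_bigr do rewrite -rng_scaleAl -path_rcons.
move=> x0; rewrite big_seq big1 // => t ts.
rewrite -rng_scaleAl path_vertex; case: eqP => tE; last by rewrite scaler0.
have [Pt|/path_not->] := boolP (path_from t.1 t.2); last by rewrite scaler0.
pose P (t : vertex E * seq (edge E)) := (t.1, rcons t.2 e).
rewrite (@paths_independent _ s c P _ us x0 t ts) ?scale0r //.
  by move=> [a b] [a' b'] [-> /rcons_inj[->]].
by rewrite /= -cats1 path_from_cat Pt tE /= eqxx.
Qed.

(** At an infinite emitter [v], an edge [e] with [f^* e = 0] for all the finitely
    many [f] that matter detects the part of [x v] without ghost edges. *)
Lemma nonregular_vertex n x v : ghost_deg g n x -> phi x = 0 ->
  (forall e, (x * ledge g e)%g = 0) -> ~ regular v -> (x * lvertex g v)%g = 0.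
Proof.
move=> xn x0 xe nreg; have [a [y [s [xE a0 yP]]]] := edge_decomposition xn.
have {yP} yE := yP (undup s) (undup_uniq s) (fun e => etrans (mem_undup s e)).
have [[e [ev es]]|noe] := pselect (exists e, src e = v /\ e \notin s).
  have ye : (y * ledge g e)%g = 0.
    rewrite yE rng_mulr_suml big_seq big1 // => f; rewrite mem_undup => fs.
    rewrite -mulgA lghost_edge; case: eqP => [fe|_]; last by rewrite rng_mul0r.
    by rewrite -fe fs in es.
  have av : (a * lvertex g v)%g = 0.
    rewrite -ev; apply: ker_paths_edge => //.
    by have := xe e; rewrite xE rng_mulDl ye addr0 => ->; rewrite raddf0.
  rewrite xE rng_mulDl av add0r yE rng_mulr_suml big1 // => f _.
  rewrite -mulgA lghost_vertex; case: eqP => [fv|_]; last by rewrite rng_mul0r.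
  have := xe f; rewrite xE rng_mulDl -[X in (a * X)%g]lsrc_edge mulgA.
  by rewrite fv av rng_mul0l add0r => ->; rewrite rng_mul0l.
(* All edges from [v] are in [s], so [v] emits finitely many edges, hence none,
   as it is not regular. *)
have outs : (out_edges v `<=` [set` s])%classic.
  by move=> e ev; apply: contrapT => /negP es; apply: noe; exists e.
have nov e : src e <> v.
  move=> ev; apply: nreg; split; first by exists e.
  exact: sub_finite_set outs (finite_seq s).
have xa : (x * lvertex g v)%g = (a * lvertex g v)%g.
  rewrite xE rng_mulDl yE rng_mulr_suml big1 ?addr0 // => f _.
  by rewrite -mulgA lghost_vertex; case: eqP => [/nov//|_]; rewrite rng_mul0r.
rewrite xa; apply: ker_paths; first exact: ghost_deg_vertex.
by rewrite -xa phi_mull.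
Qed.

Lemma ker_ghost_deg n x : ghost_deg g n x -> phi x = 0 -> x = 0.
Proof.
elim: n x => [|n IH] x xn x0; first exact: ker_paths.
have xe e : (x * ledge g e)%g = 0.
  by apply: IH; [apply: (ghost_deg_edge e xn)|apply: phi_mull].
have [s /(_ (undup s) (undup_uniq s))->] := vertex_decomposition xn; last first.
  by move=> v; rewrite mem_undup.
apply: big1 => v _.
have [reg|nreg] := pselect (regular v); last exact: nonregular_vertex xn x0 xe nreg.
rewrite (lregular g reg) fsbig_finite; last by case: reg.
by rewrite rng_mulr_sumr big1 // => e _; rewrite mulgA xe rng_mul0l.
Qed.

End Kernel.

Theorem theorem6p5 (E : graph) (R : comPzRingType)
    (L : rngAlgType R) (g : leavitt_family E L)
    (S : rngType) (phi : {rngmorphism L -> S}) :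
  condition_L E ->
  is_leavitt_path_algebra g ->
  (forall (v : vertex E) (l : R), l != 0 -> phi (l *: lvertex g v) != 0) ->
  injective phi.
Proof.
move=> EL gL phi_vertex x y xy; apply/eqP; rewrite -subr_eq0; apply/eqP.
have [n xyn] := ghost_deg_total gL (x - y).
by apply: (ker_ghost_deg EL phi_vertex xyn); rewrite raddfB /= xy subrr.
Qed.
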